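(* Let $K$ be a compact Hausdorff space and let $\mathcal{H}$ be a finite-dimensional real Hilbert space with $\dim(\mathcal{H})\geq 2$. Suppose $x_0\in S(\mathcal{H})$ and $\mathcal{O}\neq \emptyset$ is an open subset of $K$. Let $p= \chi_{\mathcal{O}}$ and $$N= \{ a\in C(K,\mathcal{H}) : a p= \mu\, x_0 \otimes p \text{ for some } \mu\in \mathbb{R} \}.$$ Then the closed unit ball of the real JB$^*$-triple $N$ coincides with the closed convex hull of its extreme points. Consequently, $\mathcal{B}_{N}$ satisfies the strong Mankiewicz property.
   Context: $C(K,\mathcal{H})$ is the Banach space of all continuous functions from $K$ to $\mathcal{H}$, with the supremum norm; it is a real JB$^*$-triple with product $\{a,b,c\}=\frac12(a|b)c+\frac12(c|b)a$, where $(a|b)(t)=(a(t)|b(t))$, and $N$ is a norm-closed subtriple. $S(X)$ and $\mathcal{B}_X$ are the unit sphere and closed unit ball of a normed space $X$. $\chi_{\mathcal{O}}$ is the characteristic function of $\mathcal{O}$ (not necessarily continuous); $ap$ is the pointwise product $t\mapsto p(t)a(t)$ and $x_0\otimes p$ is the map $t\mapsto p(t)x_0$. A convex subset $\mathcal{K}$ of a normed space $X$ satisfies the strong Mankiewicz property if every surjective isometry from $\mathcal{K}$ onto an arbitrary convex subset $L$ of a normed space $Y$ is affine. *)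

(* Defs.v *)
From HB Require Import structures.
From mathcomp Require Import all_boot all_order all_algebra.
From mathcomp Require Import interval_inference.
From mathcomp Require Import boolp classical_sets functions reals.
From mathcomp Require Import topology convex normedtype numfun.
From mathcomp Require Import ring.

Set Implicit Arguments.
Unset Strict Implicit.
Unset Printing Implicit Defensive.

Import Order.TTheory GRing.Theory Num.Theory.
Import numFieldNormedType.Exports.

Local Open Scope classical_set_scope.
Local Open Scope ring_scope.
Local Open Scope convex_scope.

HB.mixin Record NormedModule_isHilbert (R : realType) H
    & NormedModule R H := {
  inner : {dot H for @idfun R} ;
  inner_norm : forall x : H, inner x x = `|x| ^+ 2
}.

#[short(type="hilbertType")]
HB.structure Definition Hilbert (R : realType) :=
  {H of CompleteNormedModule R H & NormedModule_isHilbert R H}.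

#[short(type="finDimHilbertType")]
HB.structure Definition FinDimHilbert (R : realType) :=
  {H of Hilbert R H & Vector R H}.

Section inner_theory.
Context {R : realType} {H : hilbertType R}.
Implicit Types x y : H.

Lemma inner_polar x y :
  inner x y = (`|x + y| ^+ 2 - `|x| ^+ 2 - `|y| ^+ 2) / 2.
Proof.
rewrite -!inner_norm hnormD /= expr0 mul1r.
set u := inner x x; set v := inner y y; set w := inner x y.
by field.
Qed.

Lemma continuous_inner (K : topologicalType) (a b : K -> H) :
  continuous a -> continuous b -> continuous (fun t => inner (a t) (b t) : R).
Proof.
move=> ca cb t; rewrite /continuous_at.
under eq_fun do rewrite inner_polar; rewrite inner_polar.
have csq (f : K -> H) : f @ t --> f t -> (`|f x| ^+ 2 @[x --> t] --> `|f t| ^+ 2).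
  by move=> cf; rewrite expr2; under eq_fun do rewrite expr2;
     apply: cvgM; apply: cvg_norm.
apply: cvgMl; apply: cvgB; last exact/csq/cb.
apply: cvgB; last exact/csq/ca.
have := csq (fun x : K => a x + b x : H); apply; apply: cvgD; [exact: ca|exact: cb].
Qed.

End inner_theory.

(* The proof of compactness is part of the type: it is what makes the supremum
   norm below well defined. *)
Definition cont (K : topologicalType) (cK : compact [set: K])
  (V : topologicalType) : Type := continuousType K V.

Section cont_normed.
Context {R : realType} {K : topologicalType} {cK : compact [set: K]}.
Context {V : normedModType R}.
Local Notation C := (cont cK V).
Implicit Types a b : C.

HB.instance Definition _ := Choice.on C.

Definition mkcont (f : K -> V) (cf : continuous f) : C := mkcts cf.

Lemma contP a b : (forall t, a t = b t) -> a = b.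
Proof. by move=> ab; apply/continuousEP. Qed.

Fact cont_zero_subproof : continuous (fun _ : K => 0 : V).
Proof. exact: cst_continuous. Qed.
Fact cont_opp_subproof a : continuous (fun t => - a t).
Proof. by move=> t; apply: cvgN; exact: cts_fun. Qed.
Fact cont_add_subproof a b : continuous (fun t => a t + b t).
Proof. by move=> t; apply: cvgD; exact: cts_fun. Qed.
Fact cont_scale_subproof (r : R) a : continuous (fun t => r *: a t).
Proof. by move=> t; apply: cvgZl_tmp; exact: cts_fun. Qed.

Definition cont_zero : C := mkcont cont_zero_subproof.
Definition cont_opp a : C := mkcont (@cont_opp_subproof a).
Definition cont_add a b : C := mkcont (@cont_add_subproof a b).
Definition cont_scale (r : R) a : C := mkcont (@cont_scale_subproof r a).

Fact cont_addA : associative cont_add.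
Proof. by move=> a b c; apply: contP => t /=; exact: addrA. Qed.
Fact cont_addC : commutative cont_add.
Proof. by move=> a b; apply: contP => t /=; exact: addrC. Qed.
Fact cont_add0 : left_id cont_zero cont_add.
Proof. by move=> a; apply: contP => t /=; exact: add0r. Qed.
Fact cont_addN : left_inverse cont_zero cont_opp cont_add.
Proof. by move=> a; apply: contP => t /=; exact: addNr. Qed.

HB.instance Definition _ :=
  GRing.isZmodule.Build C cont_addA cont_addC cont_add0 cont_addN.

Fact cont_scaleA (r s : R) a :
  cont_scale r (cont_scale s a) = cont_scale (r * s) a.
Proof. by apply: contP => t /=; exact: scalerA. Qed.
Fact cont_scale1 : left_id 1 cont_scale.
Proof. by move=> a; apply: contP => t /=; exact: scale1r. Qed.
Fact cont_scaleDr : right_distributive cont_scale +%R.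
Proof. by move=> r a b; apply: contP => t /=; exact: scalerDr. Qed.
Fact cont_scaleDl a : {morph cont_scale^~ a : r s / r + s}.
Proof. by move=> r s; apply: contP => t /=; exact: scalerDl. Qed.

HB.instance Definition _ := GRing.Zmodule_isLmodule.Build R C
  cont_scaleA cont_scale1 cont_scaleDr cont_scaleDl.

Definition supnorm a : R := sup (range (fun t => `|a t|)).

Lemma supnorm_has_ubound a : has_ubound (range (fun t => `|a t|)).
Proof.
have /compact_bounded[M [_ Mb]] : compact (a @` [set: K]).
  by apply: continuous_compact => //; apply: continuous_subspaceT; exact: cts_fun.
exists (M + 1) => _ [t _ <-]; apply: (Mb (M + 1)); first by rewrite ltrDl.
by exists t.
Qed.

Lemma le_supnorm a t : `|a t| <= supnorm a.
Proof. by apply: ub_le_sup; [exact: supnorm_has_ubound|exists t]. Qed.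

Lemma supnorm_ge0 a : 0 <= supnorm a.
Proof.
have [[t _]|/set0P/negP/negPn/eqP K0] := pselect ([set: K] !=set0).
  exact: le_trans (normr_ge0 _) (le_supnorm a t).
by rewrite /supnorm K0 image_set0 sup0.
Qed.

Lemma supnorm_leP a (M : R) : 0 <= M -> (supnorm a <= M) <-> (forall t, `|a t| <= M).
Proof.
move=> M0; split=> [aM t|aM]; first exact: le_trans (le_supnorm a t) aM.
have [[t _]|/set0P/negP/negPn/eqP K0] := pselect ([set: K] !=set0); last first.
  by rewrite /supnorm K0 image_set0 sup0.
by apply: ge_sup; [exists `|a t|, t|move=> _ [s _ <-]].
Qed.

Fact supnormD a b : supnorm (a + b) <= supnorm a + supnorm b.
Proof.
apply/supnorm_leP; first by rewrite addr_ge0 ?supnorm_ge0.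
move=> t; apply: le_trans (ler_normD _ _) _.
by rewrite lerD ?le_supnorm.
Qed.

Fact supnormZ (r : R) a : supnorm (r *: a) = `|r| * supnorm a.
Proof.
apply/eqP; rewrite eq_le; apply/andP; split.
  apply/supnorm_leP; first by rewrite mulr_ge0 ?supnorm_ge0.
  by move=> t; rewrite normrZ ler_wpM2l ?le_supnorm.
have [->|r0] := eqVneq r 0; first by rewrite normr0 mul0r supnorm_ge0.
rewrite -ler_pdivlMl ?normr_gt0//; apply/supnorm_leP.
  by rewrite mulr_ge0 ?invr_ge0 ?supnorm_ge0.
move=> t; rewrite ler_pdivlMl ?normr_gt0// -normrZ.
exact: (le_supnorm (r *: a)).
Qed.

Fact supnorm0_eq0 a : supnorm a = 0 -> a = 0.
Proof.
move=> a0; apply: contP => t; apply/eqP; rewrite -normr_le0 -a0.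
exact: le_supnorm.
Qed.

HB.instance Definition _ :=
  Lmodule_isNormed.Build R C supnormD supnormZ supnorm0_eq0.

End cont_normed.

Lemma lipschitz1_continuous (R : realType) (V W : normedModType R) (f : V -> W) :
  (forall x y, `|f x - f y| <= `|x - y|) -> continuous f.
Proof.
move=> f1 x; apply/cvgrPdist_lt => e e0; near=> y.
apply: le_lt_trans (f1 x y) _; near: y.
apply: cvgr_dist_lt; [exact: cvg_id|exact: e0].
Unshelve. all: by end_near. Qed.

Section triple.
Context {R : realType} {K : topologicalType} {cK : compact [set: K]}.
Context {H : hilbertType R}.
Local Notation C := (cont cK H).
Implicit Types a b c : C.

Fact triple_subproof a b c : continuous (fun t =>
  2^-1 *: (inner (a t) (b t) *: c t) + 2^-1 *: (inner (c t) (b t) *: a t)).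
Proof.
move=> t; apply: cvgD; apply: cvgZl_tmp; apply: cvgZ; try exact: cts_fun;
  by apply: continuous_inner; exact: cts_fun.
Qed.

Definition triple a b c : C := mkcont (@triple_subproof a b c).

Lemma tripleE a b c t : triple a b c t =
  2^-1 *: (inner (a t) (b t) *: c t) + 2^-1 *: (inner (c t) (b t) *: a t).
Proof. by []. Qed.

(* \1_O is p, and t |-> \1_O t *: x0 is the tensor product of x0 and p. *)
Definition subtripleN (x0 : H) (O : set K) : set C :=
  [set a | exists mu : R,
    (fun t => \1_O t *: a t) = (fun t => mu *: (\1_O t *: x0))].

Lemma subtripleNP (x0 : H) (O : set K) a :
  subtripleN x0 O a <-> exists mu : R, forall t, O t -> a t = mu *: x0.
Proof.
split=> -[mu E]; exists mu.
  move=> t Ot; have /(congr1 (fun f => f t)) := E.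
  by rewrite indicE mem_set// !scale1r.
apply/funext => t; rewrite indicE.
have [Ot|nOt] := boolP (t \in O); first by rewrite !scale1r E //; exact: set_mem.
by rewrite !scale0r scaler0.
Qed.

Lemma subtripleN_lin (x0 : H) (O : set K) (r : R) a b :
  subtripleN x0 O a -> subtripleN x0 O b -> subtripleN x0 O (r *: a + b).
Proof.
move=> /subtripleNP[m am] /subtripleNP[n bn]; apply/subtripleNP; exists (r * m + n) => t Ot.
by rewrite scalerDl -scalerA -(am t) // -(bn t).
Qed.

Lemma subtripleN_triple (x0 : H) (O : set K) a b c :
  subtripleN x0 O a -> subtripleN x0 O b -> subtripleN x0 O c -> subtripleN x0 O (triple a b c).
Proof.
move=> /subtripleNP[l al] /subtripleNP[m bm] /subtripleNP[n cn]; apply/subtripleNP.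
exists (2^-1 * (inner (l *: x0) (m *: x0) * n)
  + 2^-1 * (inner (n *: x0) (m *: x0) * l)) => t Ot.
by rewrite tripleE (al t) // (bm t) // (cn t) // scalerDl -!scalerA.
Qed.

Lemma closed_eq_scale (T : topologicalType) (f g : T -> H) (x : H) :
  continuous f -> continuous g -> closed [set t | f t = inner (g t) x *: x].
Proof.
move=> cf cg.
rewrite (_ : [set _ | _] = (fun t => f t - inner (g t) x *: x) @^-1` [set 0]).
  apply: preimage_closed; last first.
    exact/accessible_closed_set1/hausdorff_accessible/norm_hausdorff.
  move=> t _; apply: cvgB; first exact: cf.
  apply: cvgZr_tmp; apply: (continuous_inner (b := fun=> x)) => //.
  exact: cst_continuous.
by apply/seteqP; split=> t /=; [move=> ->; rewrite subrr|move/subr0_eq].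
Qed.

Lemma subtripleN_closed (x0 : H) (O : set K) : `|x0| = 1 ->
  closed (subtripleN x0 O).
Proof.
move=> nx0; have ev_cts t : continuous (fun a : C => a t).
  by apply: lipschitz1_continuous => a b; exact: (le_supnorm (a - b)).
have [[t0 Ot0]|O0] := pselect (O !=set0); last first.
  rewrite (_ : subtripleN _ _ = setT); first exact: closedT.
  rewrite -subTset => a _; apply/subtripleNP; exists 0 => t Ot.
  by case: O0; exists t.
rewrite (_ : subtripleN _ _ = \bigcap_(t in O)
    [set a : C | a t = inner (a t0) x0 *: x0]).
  by apply: closed_bigI => t _; apply: closed_eq_scale; exact: ev_cts.
apply/seteqP; split=> a.
  move=> /subtripleNP[mu amu] t Ot /=.
  by rewrite !amu // linearZl_LR /= inner_norm nx0 expr1n mulr1.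
move=> aO; apply/subtripleNP; exists (inner (a t0) x0) => t Ot.
exact: aO.
Qed.

End triple.

Section convexity.
Context {R : realType}.
Implicit Types X Y : normedModType R.

Definition unit_ball X (N : set X) : set X := N `&` [set x | `|x| <= 1].

Definition extreme_points X (A : set X) : set X :=
  [set x | A x /\ forall (y z : convex_lmodType X) (t : {i01 R}),
    A y -> A z -> 0 < t%:num -> t%:num < 1 -> x = y <| t |> z ->
    y = x /\ z = x].

Definition convex_hull X (A : set X) : set X := smallest (@convex_set R X) A.

Definition isometric_on X Y (A : set X) (f : X -> Y) :=
  forall x y, A x -> A y -> `|f x - f y| = `|x - y|.

Definition affine_on X Y (A : set X) (f : X -> Y) :=
  forall (x y : convex_lmodType X) (t : {i01 R}), A x -> A y ->
    f (x <| t |> y) = (f x : convex_lmodType Y) <| t |> f y.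

(* Only the restriction of f to A matters, and every map defined on A extends
   to X. *)
Definition strong_Mankiewicz X (A : set X) : Prop :=
  @convex_set R X A /\
  forall (Y : normedModType R) (L : set Y) (f : X -> Y),
    @convex_set R Y L -> f @` A = L -> isometric_on A f -> affine_on A f.

End convexity.

(* Main.v *)
(** Density.  Functions in [N] with values in the unit sphere of [H] are extreme.
Given [a] in the unit ball of [N], equal to [mu x0] on [O], a partition of unity
built from distances between values of [a] yields
[a ~ c + sum_i h_i (b_i - c)], where [c = mu x0] and each [h_i] vanishes on [O].
Since [dim H >= 2], each [b_i] is the mean of two unit vectors, and [mu x0] is a
convex combination of [x0] and [- x0]; so it suffices to treat unit [b_i] and
[c = x0] or [c = - x0].  Join [c] to [b_i] by a path [rho_i] in the sphere, and
let the map of threshold [theta] in [[0, 1]] take at [t] the value [b_i] when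
[theta] lies in the [i]-th of consecutive intervals of lengths [h_i(t)], and [c]
outside of them, following [rho_i] in thin layers near the ends.  These maps are
sphere-valued and equal to [c] on [O], and their average over [theta] tends to
[c + sum_i h_i (b_i - c)] as the layers shrink.

Mankiewicz property.  If [e] is extreme in the ball, the point dividing the
segment from [p] to [p + r e] in a given ratio is determined by its distances to
the two ends, so an isometry [f] with convex image is affine in the direction
[e].  The mixed differences of [f] in two extreme directions vanish, because
convexity of the image would otherwise give a nonzero [w] with [d + w] and
[d - w] as short as [d].  Hence [f] is affine on the convex hull of the extreme
points, and everywhere by density. *)

Require Import Defs.
From mathcomp Require Import all_boot all_order all_algebra.
From mathcomp Require Import interval_inference.
From mathcomp Require Import boolp classical_sets functions reals.
From mathcomp Require Import topology convex normedtype numfun.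
From mathcomp Require Import ring lra.

Set Implicit Arguments.
Unset Strict Implicit.
Unset Printing Implicit Defensive.

Import Order.TTheory GRing.Theory Num.Theory.
Import numFieldNormedType.Exports.

Local Open Scope classical_set_scope.
Local Open Scope ring_scope.

(** * Isometries of the unit ball onto convex sets *)

Section convexity.
Context {R : realType} {X : normedModType R}.
Implicit Types (A : set X) (x y z : X) (t : R).

Lemma convex_setP A : @convex_set R X A <->
  forall x y t, 0 <= t <= 1 -> A x -> A y -> A (t *: x + (1 - t) *: y).
Proof.
split=> [cA x y t /andP[t0 t1] Ax Ay|cA x y t /set_mem Ax /set_mem Ay].
  by have /set_mem := cA x y (Itv01 t0 t1) (mem_set Ax) (mem_set Ay).
by apply/mem_set; apply: cA => //; rewrite ge0 le1.
Qed.

Lemma extreme_pointsP A x : extreme_points A x <-> A x /\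
  forall y z t, A y -> A z -> 0 < t < 1 -> x = t *: y + (1 - t) *: z ->
  y = x /\ z = x.
Proof.
split=> -[Ax ex]; split=> // y z t Ay Az.
  move=> /andP[t0 t1] xE.
  by apply: (ex y z (Itv01 (ltW t0) (ltW t1))).
by move=> t0 t1; apply: (ex y z t%:num); rewrite ?t0.
Qed.

Lemma convex_convex_hull A : @convex_set R X (convex_hull A).
Proof.
apply/convex_setP => x y t t01 Ax Ay B [cB AB].
by move/convex_setP: (cB); apply => //; [exact: Ax|exact: Ay].
Qed.

Lemma convex_set_mean A (M : nat) (u : nat -> X) : @convex_set R X A ->
  (0 < M)%N -> (forall j, A (u j)) -> A (M%:R^-1 *: \sum_(j < M) u j).
Proof.
move=> /convex_setP cA; case: M => // M _ Au; elim: M => [|M IH].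
  by rewrite big_ord1 invr1 scale1r.
have -> : (M.+2)%:R^-1 *: \sum_(j < M.+2) u j =
    (M.+1%:R / M.+2%:R) *: (M.+1%:R^-1 *: \sum_(j < M.+1) u j) +
    (1 - M.+1%:R / M.+2%:R) *: u M.+1.
  rewrite big_ord_recr/= scalerDr scalerA mulrAC divff ?pnatr_eq0// mul1r.
  congr (_ + _ *: _); apply: (@mulIf _ M.+2%:R); first by rewrite pnatr_eq0.
  by rewrite mulrBl mulVf ?pnatr_eq0// divfK ?pnatr_eq0// mul1r -natrB// subSnn.
apply: cA => //; rewrite divr_ge0 ?ler0n//= ler_pdivrMr ?ltr0n// mul1r.
by rewrite ler_nat.
Qed.

Lemma closure_normP A x :
  closure A x <-> forall e : R, 0 < e -> exists2 y, A y & `|x - y| < e.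
Proof.
split=> [clx e e0|clx B /nbhs_ballP[e /= e0 eB]].
  have [y [Ay]] := clx _ (nbhsx_ballx x e e0).
  by rewrite -ball_normE /= => xy; exists y.
have [y Ay xy] := clx e e0; exists y; split=> //.
by apply: eB; rewrite -ball_normE.
Qed.

End convexity.

Lemma convex_unit_ball (R : realType) (X : normedModType R) (N : set X) :
  N 0 -> (forall (r : R) a b, N a -> N b -> N (r *: a + b)) ->
  @convex_set R X (unit_ball N).
Proof.
move=> N0 N_lin; apply/convex_setP => u v s /andP[s0 s1] [Nu /= u1] [Nv /= v1].
split.
  by apply: (N_lin) => //; rewrite -[_ *: v]addr0; exact: N_lin.
rewrite /= (le_trans (ler_normD _ _))// !normrZ !ger0_norm ?subr_ge0//.
by nra.
Qed.

Section strong_Mankiewicz.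
Context {R : realType} {X Y : normedModType R} (N : set X).
Hypothesis N0 : N 0.
Hypothesis N_lin : forall (r : R) a b, N a -> N b -> N (r *: a + b).
Local Notation A := (unit_ball N).
Local Notation E := (extreme_points A).
Context (L : set Y) (f : X -> Y).
Hypotheses (cL : @convex_set R Y L) (fA : f @` A = L) (f_iso : isometric_on A f).

Let NZ (r : R) a : N a -> N (r *: a).
Proof. by move=> Na; rewrite -[r *: a]addr0; exact: N_lin. Qed.
Let ND a b : N a -> N b -> N (a + b).
Proof. by move=> Na Nb; rewrite -[a]scale1r; exact: N_lin. Qed.
Let NB a b : N a -> N b -> N (a - b).
Proof. by move=> Na Nb; rewrite addrC -scaleN1r; exact: N_lin. Qed.
Let EN e : E e -> N e. Proof. by case=> -[]. Qed.
Let E1 e : E e -> `|e| <= 1. Proof. by case=> -[]. Qed.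

Let convex_A : @convex_set R X A. Proof. exact: convex_unit_ball. Qed.

(** The vectors from [p] to [z] and from [z] to [p + r *: e], divided by [t * r] and [(1 - t) * r],
    lie in the ball and average to [e] with weights [t] and [1 - t]; extremality makes both equal to
    [e]. *)
Lemma extreme_metric_between e p z (r t : R) : E e -> N p -> N z ->
  0 < r -> 0 < t < 1 ->
  `|z - p| <= t * r -> `|p + r *: e - z| <= (1 - t) * r ->
  z = p + (t * r) *: e.
Proof.
move=> /extreme_pointsP[[Ne e1] ext] Np Nz r0 t01 zp pz.
have /andP[t0 t1] := t01; have s0 : 0 < 1 - t by rewrite subr_gt0.
have tr0 : 0 < t * r by rewrite mulr_gt0.
have sr0 : 0 < (1 - t) * r by rewrite mulr_gt0.
have [|||<- _] := ext ((t * r)^-1 *: (z - p))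
    (((1 - t) * r)^-1 *: (p + r *: e - z)) t _ _ t01.
- split; first by apply/NZ/NB.
  by rewrite /= normrZ ger0_norm ?invr_ge0 ?(ltW tr0)// ler_pdivrMl ?mulr1.
- split; first by apply/NZ/NB => //; apply/ND => //; exact: NZ.
  by rewrite /= normrZ ger0_norm ?invr_ge0 ?(ltW sr0)// ler_pdivrMl ?mulr1.
- rewrite !scalerA !invfM !mulrA !divff ?gt_eqF// !mul1r -scalerDr.
  by rewrite !addrA subrK addrAC subrr add0r scalerA mulVf ?gt_eqF// scale1r.
by rewrite scalerA divff ?gt_eqF// scale1r addrC subrK.
Qed.

Lemma affine_extreme_direction e p (r t : R) : E e -> A p -> A (p + r *: e) ->
  0 <= r -> 0 <= t <= 1 ->
  f (p + (t * r) *: e) = (1 - t) *: f p + t *: f (p + r *: e).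
Proof.
move=> Ee Ap Aq; rewrite le_eqVlt => /predU1P[<- _|r0].
  by rewrite mulr0 scale0r addr0 -scalerDl subrK scale1r.
move=> /andP[]; rewrite le_eqVlt => /predU1P[<- _|t0].
  by rewrite mul0r !scale0r !addr0 subr0 scale1r.
rewrite le_eqVlt => /predU1P[->|t1].
  by rewrite mul1r subrr scale0r add0r scale1r.
(* Convexity of [L] gives a preimage [z] of the combination; the isometry carries its distances to
   the two ends back to [A], where they determine [z]. *)
have : L (t *: f (p + r *: e) + (1 - t) *: f p).
  move/convex_setP : cL; apply; first by rewrite !ltW.
    by rewrite -fA; exists (p + r *: e).
  by rewrite -fA; exists p.
rewrite -{1}fA => -[z Az fz]; rewrite [RHS]addrC -fz; congr f; apply/esym.
have s0 : 0 < 1 - t by rewrite subr_gt0.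
have re : `|p + r *: e - p| <= r.
  by rewrite addrC addKr normrZ gtr0_norm// ler_piMr ?(ltW r0)// E1.
apply: extreme_metric_between => //; rewrite ?t0//; first by case: Ap.
- by case: Az.
- rewrite -f_iso// fz (_ : _ - _ = t *: (f (p + r *: e) - f p)).
    by rewrite normrZ gtr0_norm// ler_pM2l// f_iso.
  by rewrite scalerBl scale1r scalerBr addrCA (addrC (f p)) addrK.
- rewrite -f_iso// fz (_ : _ - _ = (1 - t) *: (f (p + r *: e) - f p)).
    by rewrite normrZ gtr0_norm// ler_pM2l// f_iso.
  by rewrite scalerBr (scalerBl _ _ (f (p + _))) scale1r opprD addrA.
Qed.

Let mul2I (a b : Y) : a *+ 2 = b *+ 2 -> a = b.
Proof.
move=> ab; apply: (@scalerI _ _ (2 : R)); first by rewrite pnatr_eq0.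
by rewrite !scaler_nat.
Qed.

Let mid e p (r : R) : E e -> 0 <= r -> A (p - r *: e) -> A (p + r *: e) ->
  f (p - r *: e) + f (p + r *: e) = f p *+ 2.
Proof.
move=> Ee r0 Am Ap.
have pE : p - r *: e + (2 * r) *: e = p + r *: e.
  by rewrite -addrA; congr (_ + _); rewrite mulr_natl mulr2n scalerDl addKr.
have := @affine_extreme_direction e (p - r *: e) (2 * r) 2^-1 Ee Am.
rewrite pE mulrA mulVf ?pnatr_eq0// mul1r subrK => ->//.
- rewrite (_ : 1 - 2^-1 = 2^-1 :> R); last by field.
  by rewrite -scalerDr -scaler_nat scalerA divff ?pnatr_eq0// scale1r.
- by rewrite mulr_ge0.
- by apply/andP; split; lra.
Qed.

(* Convexity of [L] gives [w] with [f (z + w) = f z + D], where [D] is the mixed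
   difference; comparing distances to [f (z + d)] and [f (z - d)] exhibits [d] as
   the midpoint of the vectors [d + w] and [d - w], both of norm at most [s]. *)
Lemma mixed_difference_eq0 e d z (r s : R) : E e -> E d -> N z ->
  0 <= r -> 0 <= s -> `|z| + r + s <= 1 ->
  f (z + r *: e + s *: d) - f (z + r *: e) = f (z + s *: d) - f z.
Proof.
move=> Ee Ed Nz r0; rewrite le_eqVlt => /predU1P[<- _|s0 zrs].
  by rewrite scale0r !addr0 !subrr.
(* The bound on the norm of [z] plus [r] plus [s] keeps a grid of nine points around [z] in the
   ball. *)
have grid (i j : R) : `|i| <= 1 -> `|j| <= 1 ->
    A (z + (i * r) *: e + (j * s) *: d).
  move=> i1 j1; split.
    by apply: ND; [apply: ND => //|]; apply/NZ/EN.
  rewrite /= (le_trans _ zrs)//.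
  have le1 k q x : `|k| <= 1 -> 0 <= q -> E x -> `|(k * q) *: x| <= q.
    move=> k1 q0 Ex; rewrite normrZ normrM (ger0_norm q0) -[leRHS]mulr1.
    by rewrite ler_pM ?mulr_ge0 ?E1// ler_piMl.
  rewrite (le_trans (ler_normD _ _))// lerD ?le1 ?(ltW s0)//.
  by rewrite (le_trans (ler_normD _ _))// lerD ?le1.
have n0 : `|0 : R| <= 1 by rewrite normr0.
have n1 : `|1 : R| <= 1 by rewrite normr1.
have m1 : `|-1 : R| <= 1 by rewrite normrN1.
have /= := (grid 0 0 n0 n0, grid 0 1 n0 n1, grid 0 (-1) n0 m1,
  grid 1 0 n1 n0, grid 1 1 n1 n1, grid 1 (-1) n1 m1,
  (grid (-1) 0 m1 n0, grid (-1) 1 m1 n1, grid (-1) (-1) m1 m1)).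
rewrite !(mul0r, mul1r, mulN1r, scale0r, addr0, scaleNr).
move=> [[[[[[A00 A01] A0m] A10] A11] A1m] [[Am0 Am1] Amm]].
have h0 := mid Ed (ltW s0) A0m A01.
have h1 := mid Ed (ltW s0) A1m A11.
have hm := mid Ed (ltW s0) Amm Am1.
have v0 := mid Ee r0 Am0 A10.
have v1 : f (z - r *: e + s *: d) + f (z + r *: e + s *: d) = f (z + s *: d) *+ 2.
  have := @mid e (z + s *: d) r Ee r0.
  by rewrite [z + s *: d - _]addrAC [z + s *: d + _]addrAC; apply.
have : L (2^-1 *: f (z + r *: e + s *: d) + (1 - 2^-1) *: f (z - r *: e - s *: d)).
  move/convex_setP : cL; apply; first by apply/andP; split; lra.
    by rewrite -fA; exists (z + r *: e + s *: d).
  by rewrite -fA; exists (z - r *: e - s *: d).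
rewrite -{1}fA (_ : 1 - 2^-1 = 2^-1 :> R) -?scalerDr; last by field.
move=> [w Aw fw].
have fw2 : f w *+ 2 = f (z + r *: e + s *: d) + f (z - r *: e - s *: d).
  by rewrite fw -scaler_nat scalerA divff ?pnatr_eq0// scale1r.
have dist x y x' y' : A x -> A y -> A x' -> A y' -> y' - x' = s *: d ->
    (f x - f y) *+ 2 = (f y' - f x') *+ 2 -> `|x - y| <= s.
  move=> Ax Ay Ax' Ay' sd /mul2I xy.
  rewrite -f_iso// xy f_iso// sd normrZ gtr0_norm//.
  by rewrite ler_piMr ?(ltW s0)// E1.
have vm : f (z - r *: e - s *: d) + f (z + r *: e - s *: d) = f (z - s *: d) *+ 2.
  have := @mid e (z - s *: d) r Ee r0.
  by rewrite [z - s *: d - _]addrAC [z - s *: d + _]addrAC; apply.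
have eq1 : (f w - f (z - s *: d)) *+ 2 =
    (f (z + r *: e + s *: d) - f (z + r *: e)) *+ 2.
  rewrite !mulrnBl fw2 -vm -h1 mulr2n (addrC (f (z + r *: e - _))).
  by rewrite !opprD !addrA !addrK.
have eq2 : (f (z + s *: d) - f w) *+ 2 =
    (f (z - r *: e + s *: d) - f (z - r *: e)) *+ 2.
  rewrite !mulrnBl fw2 -v1 -hm mulr2n (addrC (f (z - r *: e - _))).
  by rewrite !opprD !addrA !addrK.
have w1 : `|w - (z - s *: d)| <= s.
  by apply: (dist _ _ _ _ _ _ A10 A11) => //; rewrite addrC addKr.
have w2 : `|z + s *: d - w| <= s.
  by apply: (dist _ _ _ _ _ _ Am0 Am1) => //; rewrite addrC addKr.
have wz : w = z.
  have := @extreme_metric_between d (z - s *: d) w (2 * s) 2^-1 Ed.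
  rewrite mulrA mulVf ?pnatr_eq0// mul1r subrK; apply => //.
  - by case: A0m.
  - by case: Aw.
  - by rewrite mulr_gt0.
  - by apply/andP; split; lra.
  - rewrite (_ : (1 - 2^-1) * (2 * s) = s); last by field.
    rewrite (_ : z - s *: d + (2 * s) *: d = z + s *: d)//.
    by rewrite -addrA mulr_natl mulr2n scalerDl addKr.
(* With [w = z], [eq1] equates the increment at [z + r *: e] with [f z - f (z - s *: d)], which [h0]
   turns into [f (z + s *: d) - f z]. *)
move: eq1; rewrite wz => /mul2I <-.
by apply/eqP; rewrite subr_eq addrAC eq_sym subr_eq -mulr2n addrC h0.
Qed.

(** Pairs [x = sum r_i e_i], with coefficients [r_i >= 0] of total [w], with the expected value
    [y = sum r_i (f e_i - f 0)] of [f x - f 0]. A relation avoids presupposing that [y] depends only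
    on [x]. *)
Inductive extreme_comb : R -> X -> Y -> Prop :=
| extreme_comb_nil : extreme_comb 0 0 0
| extreme_comb_cons r e w x y : 0 <= r -> E e -> extreme_comb w x y ->
    extreme_comb (r + w) (r *: e + x) (r *: (f e - f 0) + y).

Lemma extreme_combD w x y w' x' y' : extreme_comb w x y ->
  extreme_comb w' x' y' -> extreme_comb (w + w') (x + x') (y + y').
Proof.
move=> c c'; elim: c => [|r e w1 x1 y1 r0 Ee c IH]; first by rewrite !add0r.
by rewrite -!addrA; exact: extreme_comb_cons.
Qed.

Lemma extreme_combZ t w x y : 0 <= t -> extreme_comb w x y ->
  extreme_comb (t * w) (t *: x) (t *: y).
Proof.
move=> t0; elim=> [|r e w1 x1 y1 r0 Ee c IH].
  by rewrite mulr0 !scaler0; exact: extreme_comb_nil.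
rewrite mulrDr [t *: (r *: e + _)]scalerDr [t *: (r *: (_ - _) + _)]scalerDr.
rewrite !scalerA; apply: extreme_comb_cons => //.
exact: mulr_ge0.
Qed.

Lemma extreme_comb_norm w x y : extreme_comb w x y -> N x /\ `|x| <= w.
Proof.
elim=> [|r e w1 x1 y1 r0 Ee c [Nx xw]]; first by rewrite normr0.
split; first by apply: ND => //; exact/NZ/EN.
rewrite (le_trans (ler_normD _ _))// lerD// normrZ ger0_norm//.
by rewrite ler_piMr// E1.
Qed.

(** By induction, [mixed_difference_eq0] strips the extreme terms off the base point one at a time;
    the total weight keeps the grids in the ball. *)
Lemma extreme_comb_shift w x y e (r : R) : extreme_comb w x y -> E e ->
  0 <= r -> r + w <= 1 -> f (x + r *: e) - f x = f (r *: e) - f 0.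
Proof.
move=> c Ee r0; elim: c => [|s d w1 x1 y1 s0 Ed c IH] le1.
  by rewrite add0r.
have [Nx x1w] := extreme_comb_norm c.
rewrite -IH; last by rewrite (le_trans _ le1)// lerD2l lerDr.
rewrite (addrC (s *: d)) mixed_difference_eq0// (le_trans _ le1)//.
by rewrite addrC lerD2l addrC lerD2l.
Qed.

(** The increment due to each term is moved to the origin by the shift lemma, and there [f] is
    affine along [e]. *)
Lemma extreme_combE w x y : extreme_comb w x y -> w <= 1 -> f x = f 0 + y.
Proof.
elim=> [|r e w1 x1 y1 r0 Ee c IH] le1; first by rewrite addr0.
have [Nx xw] := extreme_comb_norm c.
have w0 : 0 <= w1 by exact: le_trans xw.
have r1 : r <= 1 by rewrite (le_trans _ le1)// lerDl.
have A0 : A 0 by split => //=; rewrite normr0.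
have Ae : A (0 + 1 *: e) by rewrite add0r scale1r; case: Ee.
have := @affine_extreme_direction e 0 1 r Ee A0 Ae ler01.
rewrite r0 r1 !add0r mulr1 scale1r => /(_ isT) fre.
have := extreme_comb_shift c Ee r0 le1.
rewrite [in RHS]fre scalerBl scale1r addrAC (addrAC (f 0)) subrr add0r.
rewrite (addrC (- _)) -scalerBr => /eqP; rewrite subr_eq => /eqP.
rewrite [x1 + _]addrC => ->; rewrite IH; first by rewrite addrCA.
by rewrite (le_trans _ le1)// lerDr.
Qed.

Lemma convex_hull_extreme_comb x : convex_hull E x ->
  exists y w, w <= 1 /\ extreme_comb w x y.
Proof.
suff [cQ EQ] : @convex_set R X [set x | exists y w, w <= 1 /\ extreme_comb w x y]
    /\ E `<=` [set x | exists y w, w <= 1 /\ extreme_comb w x y].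
  exact: smallest_sub cQ EQ x.
split.
  apply/convex_setP => x1 x2 t /andP[t0 t1] [y1 [w1 [w11 c1]]] [y2 [w2 [w21 c2]]].
  exists (t *: y1 + (1 - t) *: y2), (t * w1 + (1 - t) * w2); split; first by nra.
  by apply: extreme_combD; apply: extreme_combZ => //; rewrite subr_ge0.
move=> e Ee; exists (1 *: (f e - f 0) + 0), (1 + 0); rewrite addr0; split=> //.
rewrite -[X in extreme_comb _ X _]scale1r -[1 *: e]addr0 -{1}[1]addr0.
by apply: extreme_comb_cons => //; exact: extreme_comb_nil.
Qed.

(** The combinations for [x] and [y], scaled and concatenated, represent the intermediate point with
    weight at most 1. *)
Lemma affine_convex_hull x y t : convex_hull E x -> convex_hull E y ->
  0 <= t <= 1 -> f (t *: x + (1 - t) *: y) = t *: f x + (1 - t) *: f y.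
Proof.
move=> /convex_hull_extreme_comb[x' [v [v1 cx]]].
move=> /convex_hull_extreme_comb[y' [w [w1 cy]]] /andP[t0 t1].
have cxy := extreme_combD (extreme_combZ t0 cx)
  (extreme_combZ (t := 1 - t) (etrans (subr_ge0 _ _) t1) cy).
rewrite (extreme_combE cxy) ?(extreme_combE cx) ?(extreme_combE cy)//; last by nra.
by rewrite !scalerDr addrACA -scalerDl (addrC t) subrK scale1r.
Qed.

Hypothesis A_dense : A `<=` closure (convex_hull E).

Lemma isometry_affine : affine_on A f.
Proof.
move=> x y t Ax Ay.
change (f (t%:num *: (x : X) + (1 - t%:num) *: (y : X)) =
  t%:num *: f x + (1 - t%:num) *: f y).
apply/eqP; rewrite -subr_eq0 -normr_eq0 eq_le normr_ge0 andbT.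
apply/ler_addgt0Pr => e e0; rewrite add0r.
have e20 : 0 < e / 2 by rewrite divr_gt0.
have hull_A : convex_hull E `<=` A.
  by apply: smallest_sub; [exact: convex_A|move=> ? []].
have [x' Ex' xx'] := (closure_normP _ _).1 (A_dense Ax) _ e20.
have [y' Ey' yy'] := (closure_normP _ _).1 (A_dense Ay) _ e20.
have t01 : 0 <= t%:num <= 1 by rewrite ge0 le1.
have tE : f (t%:num *: x' + (1 - t%:num) *: y') =
  t%:num *: f x' + (1 - t%:num) *: f y' by exact: affine_convex_hull.
have s0 : 0 <= 1 - t%:num by case/andP: t01; rewrite subr_ge0.
have Axy u v : A u -> A v -> A (t%:num *: u + (1 - t%:num) *: v).
  by move/convex_setP: convex_A; apply.
(* By isometry each summand is at most a convex combination of the distances from [x] to [x'] and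
   from [y] to [y'], hence at most [e / 2]. *)
rewrite (_ : _ - _ = (f (t%:num *: x + (1 - t%:num) *: y) -
    f (t%:num *: x' + (1 - t%:num) *: y')) +
    (t%:num *: (f x' - f x) + (1 - t%:num) *: (f y' - f y))); last first.
  by rewrite tE !scalerBr [X in _ = _ + X]addrACA -opprD addrA subrK.
rewrite (splitr e) (le_trans (ler_normD _ _))// lerD//.
  rewrite f_iso; [|exact: Axy|by apply: Axy; exact: hull_A].
  rewrite opprD addrACA -!scalerBr (le_trans (ler_normD _ _))//.
  by rewrite !normrZ !ger0_norm//; nra.
rewrite (le_trans (ler_normD _ _))// !normrZ !ger0_norm//.
rewrite !f_iso ?(distrC x') ?(distrC y')//; try exact: hull_A.
by nra.
Qed.

End strong_Mankiewicz.

Lemma strong_Mankiewicz_unit_ball (R : realType) (X : normedModType R) (N : set X) :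
  N 0 -> (forall (r : R) a b, N a -> N b -> N (r *: a + b)) ->
  unit_ball N `<=` closure (convex_hull (extreme_points (unit_ball N))) ->
  strong_Mankiewicz (unit_ball N).
Proof.
move=> N0 N_lin A_dense; split; first exact: convex_unit_ball.
by move=> Y L f cL fA f_iso; exact: (isometry_affine N0 N_lin cL fA f_iso).
Qed.

(** * Approximation by sphere-valued functions *)

Section hilbert.
Context {R : realType} {H : hilbertType R}.
Implicit Types (x y z : H) (t : R).

Lemma normD_sqr x y : `|x + y| ^+ 2 = `|x| ^+ 2 + `|y| ^+ 2 + 2 * inner x y.
Proof. by rewrite inner_polar; field. Qed.

Lemma innerZl t x y : inner (t *: x) y = t * inner x y.
Proof. by rewrite linearZl_LR. Qed.

Lemma innerC x y : inner x y = inner y x.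
Proof. by rewrite !inner_polar (addrC y) addrAC. Qed.

Lemma innerZr t x y : inner x (t *: y) = t * inner x y.
Proof. by rewrite innerC innerZl innerC. Qed.

Lemma inner0r x : inner x 0 = 0.
Proof. by rewrite -(scale0r (0 : H)) innerZr mul0r. Qed.

Lemma innerDl x y z : inner (x + y) z = inner x z + inner y z.
Proof. by rewrite linearDl. Qed.

Lemma norm_convex_sqr x y t : `|t *: x + (1 - t) *: y| ^+ 2 =
  t * `|x| ^+ 2 + (1 - t) * `|y| ^+ 2 - t * (1 - t) * `|x - y| ^+ 2.
Proof.
rewrite -(scaleN1r y) !normD_sqr !innerZl !innerZr !normrZ.
rewrite normrN1 mul1r !exprMn !real_normK ?num_real//.
by ring.
Qed.

(** In [norm_convex_sqr] a combination of norm 1 leaves no room for the term in [x - y]. *)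
Lemma sphere_rotund x y t : 0 < t < 1 -> `|x| <= 1 -> `|y| <= 1 ->
  `|t *: x + (1 - t) *: y| = 1 -> x = y.
Proof.
move=> /andP[t0 t1] x1 y1 /(congr1 (fun r => r ^+ 2)).
rewrite norm_convex_sqr expr1n => E.
have x2 : `|x| ^+ 2 <= 1 by rewrite expr_le1.
have y2 : `|y| ^+ 2 <= 1 by rewrite expr_le1.
apply/eqP; rewrite -subr_eq0 -normr_eq0 -sqrf_eq0 eq_le sqr_ge0 andbT.
have tt : 0 < t * (1 - t) by rewrite mulr_gt0 ?subr_gt0.
rewrite -(pmulr_rle0 _ tt).
by move: (`|x| ^+ 2) (`|y| ^+ 2) (`|x - y| ^+ 2) E x2 y2 => p q r; nra.
Qed.

End hilbert.

(** * Unit vectors and paths in the sphere in dimension at least two *)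

Section dim2.
Context {R : realType} {H : finDimHilbertType R}.
Hypothesis dimH : (2 <= \dim {:H})%N.
Implicit Types (x y z : H) (t : R).

Lemma unit_orthogonal y : exists2 f : H, `|f| = 1 & inner f y = 0.
Proof.
have [v vy] : exists v : H, v \notin <[y]>%VS.
  apply: contrapT => /forallNP vy.
  have : ({:H} <= <[y]>)%VS.
    by apply/subvP => v _; apply/negPn/negP; exact: vy.
  move=> /dimvS; rewrite dim_vline => /(leq_trans dimH).
  by case: (y != 0).
pose f := v - (inner v y / inner y y) *: y.
have f0 : f != 0.
  apply: contra vy; rewrite subr_eq0 => /eqP ->.
  by rewrite memvZ// memv_line.
exists (`|f|^-1 *: f).
  by rewrite normrZ ger0_norm ?invr_ge0// mulVf// normr_eq0.
rewrite innerZl innerDl -scaleNr innerZl mulNr.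
have [->|y0] := eqVneq y 0.
  by rewrite !inner0r mul0r mul0r subrr mulr0.
by rewrite divfK ?subrr ?mulr0// inner_norm sqrf_eq0 normr_eq0.
Qed.

(** Moving from [x] both ways along an orthogonal unit vector by [sqrt (1 - |x|^2)] reaches the
    sphere, by Pythagoras. *)
Lemma unit_midpoint x : `|x| <= 1 ->
  exists v w, [/\ `|v| = 1, `|w| = 1 & x = 2^-1 *: (v + w)].
Proof.
move=> x1; have [f f1 fx] := unit_orthogonal x.
have r0 : 0 <= 1 - `|x| ^+ 2 by rewrite subr_ge0 expr_le1.
have N1 (s : R) : s ^+ 2 = 1 - `|x| ^+ 2 -> `|x + s *: f| = 1.
  move=> s2; apply: (@pexpIrn _ 2); rewrite ?nnegrE//.
  rewrite normD_sqr innerZr innerC fx !mulr0 addr0 normrZ f1 mulr1 real_normK ?num_real// s2.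
  by rewrite expr1n addrC subrK.
pose s := Num.sqrt (1 - `|x| ^+ 2).
exists (x + s *: f), (x + (- s) *: f).
split; [by apply: N1; rewrite sqr_sqrtr|by apply: N1; rewrite sqrrN sqr_sqrtr|].
rewrite addrACA -scalerDl subrr scale0r addr0 -mulr2n -[x *+ 2]scaler_nat.
by rewrite scalerA mulVf ?pnatr_eq0// scale1r.
Qed.

(** The chord from [x] to [e] is normalised, after being bent by [c * (1 - c)] times [f] so as to
    miss 0. Only antipodal ends get a nonzero [f], orthogonal to [x]. *)
Lemma sphere_path x e : `|x| = 1 -> `|e| = 1 -> exists rho : R -> H,
  [/\ continuous rho, forall c, `|rho c| = 1, rho 0 = x & rho 1 = e].
Proof.
move=> x1 e1.
have [f fE] : exists f : H, forall c : R,
    (1 - c) *: x + c *: e + (c * (1 - c)) *: f != 0.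
  have [ex|ex] := eqVneq e (- x); last first.
    exists 0 => c; rewrite scaler0 addr0; apply: contra ex => /eqP E.
    have cc : `|1 - c| = `|c|.
      move/eqP: E; rewrite addr_eq0 => /eqP /(congr1 Num.norm).
      by rewrite normrN !normrZ x1 e1 !mulr1.
    have c2 : c = 2^-1.
      have : (1 - c) ^+ 2 = c ^+ 2 by
        rewrite -(real_normK (num_real (1 - c))) cc real_normK ?num_real.
      by move=> E2; apply: (@mulfI _ 2) => //; rewrite mulfV//; nra.
    move: E; rewrite c2 (_ : 1 - 2^-1 = 2^-1 :> R); last by field.
    by rewrite -scalerDr => /eqP; rewrite scaler_eq0 invr_eq0 pnatr_eq0/= addrC addr_eq0.
  have [f f1 fx] := unit_orthogonal x; exists f => c; rewrite ex.
  apply/eqP => E.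
  have xx : inner x x = 1 by rewrite inner_norm x1 expr1n.
  have c2 : c = 2^-1.
    (* Pairing with [x] leaves [1 - 2c = 0]; at [c = 1/2] the chord vanishes and the bend does
       not. *)
    move: (congr1 (fun v => inner v x) E).
    rewrite -(scaleN1r x) !innerDl !innerZl fx xx innerC inner0r => E2.
    by apply: (@mulfI _ 2) => //; rewrite mulfV//; lra.
  move: E; rewrite c2 (_ : 1 - 2^-1 = 2^-1 :> R); last by field.
  rewrite scalerN subrr add0r => /eqP; rewrite scaler_eq0 -[f == 0]normr_eq0 f1.
  by rewrite mulf_eq0 !invr_eq0 pnatr_eq0 oner_eq0.
pose g c := (1 - c) *: x + c *: e + (c * (1 - c)) *: f.
have g_cts : continuous g.
  move=> c; apply: cvgD; first apply: cvgD.
  - by apply: cvgZr_tmp; apply: cvgB; [exact: cvg_cst|exact: cvg_id].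
  - by apply: cvgZr_tmp; exact: cvg_id.
  - apply: cvgZr_tmp; apply: cvgM; first exact: cvg_id.
    by apply: cvgB; [exact: cvg_cst|exact: cvg_id].
exists (fun c => `|g c|^-1 *: g c); split.
- move=> c; apply: cvgZ; last exact: g_cts.
  by apply: cvgV; rewrite ?normr_eq0 ?fE//; apply: cvg_norm; exact: g_cts.
- by move=> c; rewrite normrZ ger0_norm ?invr_ge0// mulVf// normr_eq0 fE.
- by rewrite /g subr0 scale1r mul0r !scale0r !addr0 x1 invr1 scale1r.
- by rewrite /g subrr mulr0 !scale0r add0r addr0 scale1r e1 invr1 scale1r.
Qed.

End dim2.

(** * Trapezoidal functions sampled at the integers *)

Section plateau.
Context {R : realType}.
Implicit Types A B C c : R.

Definition clamp c : R := Num.max 0 (Num.min 1 c).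

Lemma clamp_ge0 c : 0 <= clamp c.
Proof. by rewrite /clamp le_max lexx. Qed.

Lemma clamp_le1 c : clamp c <= 1.
Proof. by rewrite /clamp ge_max ler01 ge_min lexx. Qed.

Lemma clamp_eq0 c : c <= 0 -> clamp c = 0.
Proof. by move=> c0; apply/max_idPl; rewrite ge_min c0 orbT. Qed.

Lemma clamp_eq1 c : 1 <= c -> clamp c = 1.
Proof. by move=> c1; rewrite /clamp (min_idPl c1); apply/max_idPr. Qed.

Lemma clamp_id c : 0 <= c <= 1 -> clamp c = c.
Proof.
by move=> /andP[c0 c1]; rewrite /clamp (min_idPr c1); apply/max_idPr.
Qed.

Lemma clamp_continuous : continuous clamp.
Proof.
move=> c; apply: (@continuous_max _ _ (fun=> 0) (fun c => Num.min 1 c)).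
  exact: cvg_cst.
apply: (@continuous_min _ _ (fun=> 1) id); [exact: cvg_cst|exact: cvg_id].
Qed.

(** The [j]-th term is the length of the part of [[j, j + 1]] below [C]. *)
Lemma sum_clamp C (M : nat) : 0 <= C ->
  \sum_(j < M) clamp (C - j%:R) = Num.min M%:R C.
Proof.
move=> C0; elim: M => [|M IH]; first by rewrite big_ord0; apply/esym/min_idPl.
rewrite big_ord_recr/= IH -natr1.
have [MC|CM] := leP M%:R C.
  have [MC1|CM1] := leP (M%:R + 1) C.
    by rewrite clamp_eq1// lerBrDl.
  by rewrite clamp_id ?subrKC// subr_ge0 MC lerBlDl ltW.
rewrite clamp_eq0 ?addr0 ?subr_le0 ?ltW//.
by apply/esym/min_idPr; rewrite (le_trans (ltW CM))// lerDl.
Qed.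

(** A trapezoid with ramps of length 1 inside [[A, B]]; it reaches 1 only if [B - A >= 2]. *)
Definition plateau A B c := clamp (Num.min (B - c) (c - A)).

Lemma plateau_gt0 A B c : 0 < plateau A B c -> A < c < B.
Proof.
move=> b0; rewrite -subr_gt0 -(subr_gt0 c) andbC -lt_min ltNge.
by apply/negP => /clamp_eq0 bE; move: b0; rewrite /plateau bE ltxx.
Qed.

(** A majorant of the indicator of [[A - 1, A + 1]] whose sums [sum_clamp] computes. *)
Let straddle A c := clamp (A + 2 - c) - clamp (A - 1 - c).

Let straddle_ge0 A c : 0 <= straddle A c.
Proof.
rewrite /straddle subr_ge0; have [cA|Ac] := leP (A - 1 - c) 0.
  by rewrite (clamp_eq0 cA) clamp_ge0.
by rewrite (@clamp_eq1 (A + 2 - c)) ?clamp_le1//; lra.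
Qed.

Let straddle1 A c : A - 1 <= c <= A + 1 -> straddle A c = 1.
Proof.
move=> /andP[Ac cA]; rewrite /straddle clamp_eq1; last by lra.
by rewrite clamp_eq0 ?subr0//; lra.
Qed.

Let sum_straddle A (M : nat) : 0 <= A -> \sum_(j < M) straddle A j%:R <= 3.
Proof.
move=> A0; rewrite sumrB sum_clamp; last by lra.
have [A1|A1] := leP 1 A.
  rewrite sum_clamp; last by lra.
  by rewrite !minEle; case: ifP => ?; case: ifP => ?; lra.
rewrite big1 ?subr0; last first.
  by move=> i _; apply: clamp_eq0; have := ler0n R i; lra.
by rewrite ge_min; apply/orP; right; lra.
Qed.

Variables (V : normedModType R) (rho : R -> V) (x e : V).
Hypotheses (rho1 : forall c, `|rho c| <= 1) (rho_x : rho 0 = x) (rho_e : rho 1 = e).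

(* [clamp (B - c) - clamp (A - c)] has exact sum [B - A] over the integers
   [0 <= c < M] when [0 <= A <= B <= M], while [plateau A B] vanishes outside [[A, B]]; they agree away from [A] and [B]. *)
Let plateau_err A B c : A <= B ->
  `|rho (plateau A B c) - x - (clamp (B - c) - clamp (A - c)) *: (e - x)| <=
  4 * (straddle A c + straddle B c).
Proof.
move=> AB.
have x1 : `|x| <= 1 by rewrite -rho_x.
have e1 : `|e| <= 1 by rewrite -rho_e.
(* This crude bound, two vectors of norm at most 2, serves within distance 1 of [A] or [B];
   elsewhere the error is 0. *)
have le4 : `|rho (plateau A B c) - x - (clamp (B - c) - clamp (A - c)) *: (e - x)| <= 4.
  have d1 : `|clamp (B - c) - clamp (A - c)| <= 1.
    have := (clamp_ge0 (B - c), clamp_ge0 (A - c), clamp_le1 (B - c), clamp_le1 (A - c)).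
    by move=> [[[? ?] ?] ?]; rewrite ler_norml; apply/andP; split; lra.
  have ex : `|e - x| <= 2 by rewrite (le_trans (ler_normB _ _))//; lra.
  have rx : `|rho (plateau A B c) - x| <= 2.
    by rewrite (le_trans (ler_normB _ _))//; have := rho1 (plateau A B c); lra.
  rewrite (le_trans (ler_normB _ _))// normrZ.
  by have := normr_ge0 (e - x); nra.
have [nA nB] := (straddle_ge0 A c, straddle_ge0 B c).
have [Ac|Ac] := boolP (A - 1 <= c <= A + 1).
  by apply: (le_trans le4); rewrite (straddle1 Ac); lra.
have [Bc|Bc] := boolP (B - 1 <= c <= B + 1).
  by apply: (le_trans le4); rewrite (straddle1 Bc); lra.
suff -> : rho (plateau A B c) - x - (clamp (B - c) - clamp (A - c)) *: (e - x) = 0.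
  by rewrite normr0; lra.
move: Ac; rewrite negb_and -!ltNge => /orP[cA|Ac].
  rewrite (_ : clamp (B - c) = 1); last by apply: clamp_eq1; lra.
  rewrite (_ : clamp (A - c) = 1); last by apply: clamp_eq1; lra.
  have -> : plateau A B c = 0.
    by apply: clamp_eq0; rewrite ge_min; apply/orP; right; lra.
  by rewrite rho_x !subrr scale0r subrr.
move: Bc; rewrite negb_and -!ltNge => /orP[cB|Bc].
  rewrite (_ : clamp (B - c) = 1); last by apply: clamp_eq1; lra.
  rewrite (_ : clamp (A - c) = 0); last by apply: clamp_eq0; lra.
  have -> : plateau A B c = 1.
    by apply: clamp_eq1; rewrite le_min; apply/andP; split; lra.
  by rewrite rho_e subr0 scale1r subrr.
rewrite (_ : clamp (B - c) = 0); last by apply: clamp_eq0; lra.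
rewrite (_ : clamp (A - c) = 0); last by apply: clamp_eq0; lra.
have -> : plateau A B c = 0.
  by apply: clamp_eq0; rewrite ge_min; apply/orP; left; lra.
by rewrite rho_x !subrr scale0r subrr.
Qed.

(** The constant is [4 * (3 + 3)]: error 4, times at most 3 from the straddle sum at each
    endpoint. *)
Lemma sum_plateau A B (M : nat) : 0 <= A -> A <= B -> B <= M%:R ->
  `|\sum_(j < M) (rho (plateau A B j%:R) - x) - (B - A) *: (e - x)| <= 24.
Proof.
move=> A0 AB BM.
have -> : B - A = \sum_(j < M) (clamp (B - j%:R) - clamp (A - j%:R)).
  rewrite sumrB !sum_clamp//; last exact: le_trans AB.
  by rewrite (min_idPr BM) (min_idPr (le_trans AB BM)).
rewrite scaler_suml -sumrB (le_trans (ler_norm_sum _ _ _))//.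
have /le_trans -> // : \sum_(j < M) `|rho (plateau A B j%:R) - x -
    (clamp (B - j%:R) - clamp (A - j%:R)) *: (e - x)| <=
    \sum_(j < M) 4 * (straddle A j%:R + straddle B j%:R).
  by apply: ler_sum => j _; exact: plateau_err.
rewrite -mulr_sumr big_split/=.
have := sum_straddle M A0; have := sum_straddle M (le_trans A0 AB).
by move: (\sum_(j < M) straddle A j%:R) (\sum_(j < M) straddle B j%:R) => p q; lra.
Qed.

End plateau.

(** * Interpolants as limits of means of sphere-valued functions *)

Section interpolation.
Context {R : realType} {K : topologicalType} {cK : compact [set: K]}.
Context {H : finDimHilbertType R}.
Hypothesis dimH : (2 <= \dim {:H})%N.
Local Notation C := (cont cK H).

(** Strict convexity of the norm of [H] is applied at each point. *)
Lemma sphere_valued_extreme (N : set C) (u : C) : N u -> (forall t, `|u t| = 1) ->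
  extreme_points (unit_ball N) u.
Proof.
move=> Nu u1; apply/extreme_pointsP; split.
  by split=> //; apply/(supnorm_leP u ler01) => t; rewrite u1.
move=> y z s [_ y1] [_ z1] s01 uE.
have yz t : y t = z t.
  apply: (sphere_rotund s01).
  - by move: t; apply/(supnorm_leP y ler01).
  - by move: t; apply/(supnorm_leP z ler01).
  - by have := u1 t; rewrite uE.
have uy t : u t = y t.
  by rewrite uE -[LHS]/(s *: y t + (1 - s) *: z t) -yz -scalerDl subrKC scale1r.
by split; apply: contP => t; rewrite uy ?yz.
Qed.

Context (x0 : H) (nx0 : `|x0| = 1) (O : set K).
Local Notation N := (subtripleN x0 O : set C).
Local Notation hull := (convex_hull (extreme_points (unit_ball N))).

Context (n : nat) (h : nat -> K -> R).
Hypotheses (h_cts : forall i, continuous (h i)) (h_ge0 : forall i t, 0 <= h i t).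
Hypothesis h_le1 : forall t, \sum_(i < n) h i t <= 1.
Hypothesis hO : forall i t, O t -> h i t = 0.

Let S i t : R := \sum_(k < i) h k t.

Let S_cts i : continuous (S i).
Proof.
by apply: continuous_big => [|k _]; [exact: add_continuous|exact: h_cts].
Qed.

Let S_homo t : {homo S^~ t : i j / (i <= j)%N >-> i <= j}.
Proof.
apply: homo_leq => [i|j i k|i]; [exact: lexx|exact: le_trans|].
by rewrite /S big_ord_recr/= lerDl.
Qed.

Definition interpolant x (e : nat -> H) t : H :=
  x + \sum_(i < n) h i t *: (e i - x).

(** The map of threshold [j / M], with everything rescaled by [M], so that the layers have length
    1. *)
Let walk (rho : nat -> R -> H) (x : H) (M j : nat) t : H :=
  x + \sum_(i < n) (rho i (plateau (M%:R * S i t) (M%:R * S i.+1 t) j%:R) - x).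

Let walk_cts rho x M j : (forall i, continuous (rho i)) ->
  continuous (walk rho x M j).
Proof.
move=> rho_cts t; apply: cvgD; first exact: cvg_cst.
move: t; apply: continuous_big => [|i _ t]; first exact: add_continuous.
apply: cvgB; last exact: cvg_cst.
apply: (@continuous_comp _ _ _ (fun t => plateau _ _ _) (rho i)); last exact: rho_cts.
apply: (@continuous_comp _ _ _ (fun t => Num.min _ _) clamp); last exact: clamp_continuous.
apply: (@continuous_min _ _ (fun t => _ - _) (fun t => _ - _)).
  by apply: cvgB; [apply: cvgMl_tmp; exact: S_cts|exact: cvg_cst].
by apply: cvgB; [exact: cvg_cst|apply: cvgMl_tmp; exact: S_cts].
Qed.

(* The intervals [M S_i, M S_(i+1)] have disjoint interiors, so at most one path
   is away from its origin [x]. *)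
Let walk_norm rho x M j t : (forall i, rho i 0 = x) ->
  (forall i c, `|rho i c| = 1) -> `|x| = 1 -> `|walk rho x M j t| = 1.
Proof.
move=> rho0 rho1 x1; rewrite /walk.
have b0 (i : 'I_n) : ~~ (0 < plateau (M%:R * S i t) (M%:R * S i.+1 t) j%:R) ->
    plateau (M%:R * S i t) (M%:R * S i.+1 t) j%:R = 0.
  by rewrite -leNgt => bi; apply/le_anti; rewrite bi clamp_ge0.
have [/existsP[i bi]|] := boolP [exists i : 'I_n,
    0 < plateau (M%:R * S i t) (M%:R * S i.+1 t) j%:R]; last first.
  rewrite negb_exists => /forallP bi; rewrite big1 ?addr0// => i _.
  by rewrite b0// rho0 subrr.
rewrite (bigD1 i)//= big1 ?addr0 => [|k ki]; first by rewrite addrC subrK.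
rewrite b0 ?rho0 ?subrr//; apply: contra ki => /plateau_gt0 /andP[k1 k2].
have /andP[i1 i2] := plateau_gt0 bi; rewrite -val_eqE eqn_leq.
have M0 : 0 <= M%:R :> R by [].
apply/andP; split; rewrite leqNgt; apply/negP => /(S_homo t) /(ler_wpM2l M0).
  by move=> /(lt_le_trans i2) /lt_trans /(_ k1); rewrite ltxx.
by move=> /(lt_le_trans k2) /lt_trans /(_ i1); rewrite ltxx.
Qed.

(** After exchanging the sums, each of the [n] indices is an instance of [sum_plateau] on an
    interval of length [M * h i t], and costs 24 before division by [M]. *)
Let walk_mean rho x (e : nat -> H) M t : (0 < M)%N ->
  (forall i c, `|rho i c| = 1) -> (forall i, rho i 0 = x) -> (forall i, rho i 1 = e i) ->
  `|M%:R^-1 *: \sum_(j < M) walk rho x M j t - interpolant x e t| <= 24 * n%:R / M%:R.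
Proof.
move=> M0 rho1 rho0 rhoe.
have MR : 0 < M%:R :> R by rewrite ltr0n.
rewrite /walk big_split/= sumr_const card_ord exchange_big/= scalerDr.
rewrite -[x *+ M]scaler_nat scalerA mulVf ?gt_eqF// scale1r.
rewrite /interpolant opprD addrACA subrr add0r.
have -> : \sum_(i < n) h i t *: (e i - x) =
    M%:R^-1 *: \sum_(i < n) (M%:R * S i.+1 t - M%:R * S i t) *: (e i - x).
  rewrite scaler_sumr; apply: eq_bigr => i _; rewrite scalerA -mulrBr mulKf ?gt_eqF//.
  by rewrite /S big_ord_recr/= addrAC subrr add0r.
rewrite -scalerBr -sumrB normrZ ger0_norm ?invr_ge0// mulrC ler_pM2r ?invr_gt0//.
rewrite (le_trans (ler_norm_sum _ _ _))//.
have /le_trans -> // : \sum_(i < n) `|\sum_(j < M) (rho i (plateau (M%:R * S i t)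
    (M%:R * S i.+1 t) j%:R) - x) - (M%:R * S i.+1 t - M%:R * S i t) *: (e i - x)| <=
    \sum_(i < n) (24 : R).
  apply: ler_sum => i _; apply: sum_plateau => //.
  - by move=> c; rewrite rho1.
  - by rewrite mulr_ge0// sumr_ge0.
  - by rewrite ler_pM2l// S_homo.
  - by rewrite ler_piMr ?ler0n// (le_trans _ (h_le1 t))// S_homo.
by rewrite sumr_const card_ord mulr_natr.
Qed.

(** Uniform approximation, stated pointwise because [interpolant] is a bare function and not an
    element of [C]. *)
Definition hull_approximates x e := forall eps : R, 0 < eps ->
  exists2 u : C, hull u & forall t, `|u t - interpolant x e t| <= eps.

Lemma hull_approximates_unit (s : R) (e : nat -> H) : `|s| = 1 -> (forall i, `|e i| = 1) ->
  hull_approximates (s *: x0) e.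
Proof.
move=> s1 e1 eps eps0; have x1 : `|s *: x0| = 1 by rewrite normrZ s1 nx0 mulr1.
have /choice[rho rhoP] : forall i, exists rho : R -> H, [/\ continuous rho,
    forall c, `|rho c| = 1, rho 0 = s *: x0 & rho 1 = e i].
  by move=> i; exact: sphere_path.
have [rho_cts rho1 rho0 rhoe] : [/\ forall i, continuous (rho i),
    forall i c, `|rho i c| = 1, forall i, rho i 0 = s *: x0 & forall i, rho i 1 = e i].
  by split=> i; case: (rhoP i).
(* This makes the error [24 * n / M] of [walk_mean] smaller than [eps]. *)
pose M := (Num.truncn (24 * n%:R / eps)).+1.
pose u j : C := mkcont (@walk_cts rho (s *: x0) M j rho_cts).
exists (M%:R^-1 *: \sum_(j < M) u j).
  apply: convex_set_mean => //; first exact: convex_convex_hull.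
  move=> j; apply: sub_gen_smallest; apply: sphere_valued_extreme => [|t]; last first.
    exact: walk_norm.
  (* On [O] every interval degenerates to a point, so all plateaus vanish and the walk stays at
     [s *: x0]. *)
  apply/subtripleNP; exists s => t Ot.
  rewrite -[LHS]/(walk rho (s *: x0) M j t) /walk big1 ?addr0// => i _.
  rewrite (_ : plateau _ _ _ = 0) ?rho0 ?subrr//.
  apply: clamp_eq0; rewrite ge_min /S big_ord_recr/= (hO _ Ot) addr0.
  by rewrite !subr_le0 le_total.
move=> t.
have -> : (M%:R^-1 *: \sum_(j < M) u j : C) t =
    M%:R^-1 *: \sum_(j < M) walk rho (s *: x0) M j t.
  rewrite /=; congr (_ *: _).
  by elim/big_ind2 : _ => // v1 w1 v2 w2 <- <-.
apply: (le_trans (walk_mean _ _ rho1 rho0 rhoe)) => //.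
rewrite ler_pdivrMr ?ltr0n// [leRHS]mulrC -ler_pdivrMr// ltW//.
exact: truncnS_gt.
Qed.

(** The interpolant is jointly affine in its origin and its targets. *)
Lemma hull_approximates_convex (s : R) x y e f : 0 <= s <= 1 ->
  hull_approximates x e -> hull_approximates y f ->
  hull_approximates (s *: x + (1 - s) *: y) (fun i => s *: e i + (1 - s) *: f i).
Proof.
move=> s01 xe yf eps eps0.
have [u uh uE] := xe _ eps0; have [v vh vE] := yf _ eps0.
exists (s *: u + (1 - s) *: v).
  by have /convex_setP := @convex_convex_hull _ _ (extreme_points (unit_ball N)); apply.
move=> t; have /andP[s0 s1] := s01.
have -> : (s *: u + (1 - s) *: v : C) t -
    interpolant (s *: x + (1 - s) *: y) (fun i => s *: e i + (1 - s) *: f i) t =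
    s *: (u t - interpolant x e t) + (1 - s) *: (v t - interpolant y f t).
  rewrite /= !scalerBr addrACA -opprD; congr (_ - _).
  rewrite /interpolant !scalerDr addrACA; congr (_ + _).
  rewrite !scaler_sumr -big_split/=; apply: eq_bigr => i _.
  by rewrite !scalerA !(mulrC _ (h i t)) -!scalerA -scalerDr; congr (_ *: _);
    rewrite opprD addrACA -!scalerBr.
rewrite (le_trans (ler_normD _ _))// !normrZ !ger0_norm ?subr_ge0//.
by have := uE t; have := vE t; nra.
Qed.

End interpolation.

(** * Partitions of unity built from the values of a function *)

Section partition.
Context {R : realType} {K : topologicalType} (cK : compact [set: K]).
Context {V : normedModType R}.

Lemma finite_net (a : K -> V) (d : R) : continuous a -> 0 < d ->
  exists l : seq V, (forall v, v \in l -> exists t, v = a t) /\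
    forall t, exists2 v, v \in l & `|a t - v| < d.
Proof.
move=> a_cts d0.
have : compact (a @` [set: K]).
  by apply: continuous_compact => //; exact: continuous_subspaceT.
rewrite compact_cover => /(_ V (range a) (fun v => ball v d)).
case=> [v _|_ [t _ <-]|D Da cov]; first exact: ball_open.
  by exists (a t) => //; exact: ballxx.
exists (finmap.enum_fset D); split=> [v /Da /set_mem[t _ <-]|t]; first by exists t.
have [v /= vD] := cov _ (ex_intro2 _ _ t I erefl : (a @` [set: K]) (a t)).
by rewrite -ball_normE /= distrC => av; exists v.
Qed.

(** The [b i] form a [d]-net of values of [a]. Their tents are multiplied by the distance from [a t]
    to [c], so the weights vanish where [a t = c]; the tent of [c] keeps the total [W] positive
    there. A tent is nonzero only within [d] of its centre, whence the error bound. *)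
Lemma partition_near (a : K -> V) (c : V) (d : R) : continuous a -> 0 < d ->
  (forall t, `|a t| <= 1) ->
  exists n (h : nat -> K -> R) (b : nat -> V),
  [/\ forall i, continuous (h i), forall i t, 0 <= h i t,
      forall t, \sum_(i < n) h i t <= 1, forall i t, a t = c -> h i t = 0 &
      (forall i, `|b i| <= 1) /\
      forall t, `|a t - (c + \sum_(i < n) h i t *: (b i - c))| <= d].
Proof.
move=> a_cts d0 a1; have [l [la net]] := finite_net a_cts d0.
(* Past the end of the net the default 0 still satisfies the norm bound. *)
pose b i := nth 0 l i.
pose tent v t : R := Num.max 0 (d - `|a t - v|).
pose w i t := tent (b i) t * `|a t - c|.
pose W t := tent c t + \sum_(i < size l) w i t.
have tent_ge0 v t : 0 <= tent v t by rewrite le_max lexx.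
have tent_cts v : continuous (tent v).
  move=> t; apply: (@continuous_max _ _ (fun=> 0) (fun t => _ - _)).
    exact: cvg_cst.
  apply: cvgB; first exact: cvg_cst.
  by apply: cvg_norm; apply: cvgB; [exact: a_cts|exact: cvg_cst].
have w_ge0 i t : 0 <= w i t by rewrite mulr_ge0.
have w_cts i : continuous (w i).
  move=> t; apply: cvgM; first exact: tent_cts.
  by apply: cvg_norm; apply: cvgB; [exact: a_cts|exact: cvg_cst].
have W_cts : continuous W.
  move=> t; apply: cvgD; first exact: tent_cts.
  by move: t; apply: continuous_big => [|i _]; [exact: add_continuous|exact: w_cts].
have W_gt0 t : 0 < W t.
  have sw : 0 <= \sum_(i < size l) w i t by exact: sumr_ge0.
  have [ac|ac] := eqVneq (a t) c.
    by rewrite ltr_wpDr// /tent ac subrr normr0 subr0 lt_max d0 orbT.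
  have [v vl av] := net t.
  have vi : (index v l < size l)%N by rewrite index_mem.
  rewrite ltr_wpDl// (bigD1 (Ordinal vi))//= ltr_wpDr ?sumr_ge0//.
  rewrite mulr_gt0 ?normr_gt0 ?subr_eq0// /tent /b nth_index// lt_max subr_gt0.
  by rewrite av orbT.
have tent_dist v t : tent v t * `|a t - v| <= tent v t * d.
  rewrite /tent; have [|dv] := leP (d - `|a t - v|) 0; first by rewrite !mul0r.
  by rewrite ler_pM2l// -subr_ge0 ltW.
exists (size l), (fun i t => w i t / W t), b; split.
- move=> i t; apply: cvgM; first exact: w_cts.
  by apply: cvgV; [rewrite gt_eqF|exact: W_cts].
- by move=> i t; rewrite divr_ge0// ltW.
- by move=> t; rewrite -mulr_suml ler_pdivrMr// mul1r lerDr.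
- by move=> i t ac; rewrite /w ac subrr normr0 mulr0 mul0r.
split=> [i|t].
  have [il|il] := ltnP i (size l); last by rewrite /b nth_default// normr0.
  by rewrite /b; have [t ->] := la _ (mem_nth 0 il).
have -> : a t - (c + \sum_(i < size l) (w i t / W t) *: (b i - c)) =
    (W t)^-1 *: (tent c t *: (a t - c) + \sum_(i < size l) w i t *: (a t - b i)).
  apply: (@scalerI _ _ (W t)); first by rewrite gt_eqF.
  rewrite [RHS]scalerA divff ?gt_eqF// scale1r opprD addrA scalerBr scaler_sumr.
  rewrite {1}/W scalerDl -addrA scaler_suml -sumrB; congr (_ + _).
  apply: eq_bigr => i _; rewrite scalerA mulrCA divff ?gt_eqF// mulr1 -scalerBr.
  by congr (_ *: _); rewrite opprB addrA subrK.
rewrite normrZ ger0_norm ?invr_ge0 ?(ltW (W_gt0 t))// ler_pdivrMl//.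
rewrite (le_trans (ler_normD _ _))// /W mulrDl lerD//.
  by rewrite normrZ ger0_norm.
rewrite mulr_suml (le_trans (ler_norm_sum _ _ _))//; apply: ler_sum => i _.
rewrite normrZ ger0_norm// /w mulrAC [leRHS]mulrAC.
by rewrite ler_wpM2r.
Qed.

End partition.

Theorem proposition4p10 (R : realType) (K : topologicalType)
    (cK : compact [set: K]) (hK : hausdorff_space K)
    (H : finDimHilbertType R) (dimH : (2 <= \dim {:H})%N)
    (x0 : H) (nx0 : `|x0| = 1) (O : set K) (O0 : O !=set0) (oO : open O) :
  let N : set (cont cK H) := subtripleN x0 O in
  unit_ball N = closure (convex_hull (extreme_points (unit_ball N))) /\
  strong_Mankiewicz (unit_ball N).
Proof.
move=> N.
have N0 : N 0 by apply/subtripleNP; exists 0 => t _; rewrite scale0r.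
have N_lin (r : R) a b : N a -> N b -> N (r *: a + b) by exact: subtripleN_lin.
suff dense : unit_ball N `<=` closure (convex_hull (extreme_points (unit_ball N))).
  split; last exact: strong_Mankiewicz_unit_ball.
  apply/seteqP; split=> // a cl_a.
  have hull_N : convex_hull (extreme_points (unit_ball N)) `<=` unit_ball N.
    by apply: smallest_sub; [exact: convex_unit_ball|move=> ? []].
  split.
    have /closure_id -> : closed N by exact: subtripleN_closed.
    by apply: closure_subset cl_a => u /hull_N[].
  apply/ler_addgt0Pr => e e0.
  have [u /hull_N[_ /= u1] au] := (closure_normP _ _).1 cl_a e e0.
  have := ler_normD (a - u) u; rewrite subrK => /le_trans; apply.
  by rewrite addrC lerD// ltW.
move=> a [/subtripleNP[mu amu] /= a1]; apply/closure_normP => eps eps0.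
have at1 t : `|a t| <= 1 by move: t; apply/(supnorm_leP a ler01).
have mu1 : `|mu| <= 1.
  by case: O0 => t Ot; have := at1 t; rewrite (amu t)// normrZ nx0 mulr1.
(* One [eps / 4] is for the partition, one for the hull; their sum [eps / 2] leaves the strict
   inequality required by [closure_normP]. *)
have d0 : 0 < eps / 4 by rewrite divr_gt0.
have [n [h [b [h_cts h_ge0 h_le1 h0 [b1 ab]]]]] :=
  partition_near cK (mu *: x0) (@cts_fun _ _ a) d0 at1.
have hO i t : O t -> h i t = 0 by move=> /amu; exact: h0.
have /choice[v /choice[w vw]] : forall i, exists v w : H,
    [/\ `|v| = 1, `|w| = 1 & b i = 2^-1 *: (v + w)].
  by move=> i; exact: unit_midpoint.
pose near := @hull_approximates R K cK H x0 O n h.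
(* The targets [v] and [w] share the origin [s *: x0], so averaging them yields [b] and leaves the
   origin fixed. *)
have near_sign (s : R) : `|s| = 1 -> near (s *: x0) b.
  move=> s1; have hf : 0 <= (2^-1 : R) <= 1 by apply/andP; split; lra.
  have nv : near (s *: x0) v by apply: hull_approximates_unit => // i; case: (vw i).
  have nw : near (s *: x0) w by apply: hull_approximates_unit => // i; case: (vw i).
  have := hull_approximates_convex hf nv nw.
  rewrite -scalerDl subrKC scale1r (_ : (fun i => _) = b)//.
  apply/funext => i; have [_ _ ->] := vw i.
  by rewrite scalerDr (_ : 1 - 2^-1 = 2^-1 :> R)//; field.
have [mu_m mu_p] : -1 <= mu /\ mu <= 1 by apply/andP; rewrite -ler_norml.
(* The weight that writes [mu] as a convex combination of 1 and -1. *)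
have l01 : 0 <= (1 + mu) / 2 <= 1 by apply/andP; split; lra.
have := hull_approximates_convex l01 (near_sign 1 (normr1 _)) (near_sign (-1) (normrN1 _)).
rewrite !scalerA -scalerDl (_ : _ + _ = mu); last by field.
rewrite (_ : (fun i => _) = b); last first.
  by apply/funext => i; rewrite -scalerDl subrKC scale1r.
move=> /(_ _ d0)[u hu uT]; exists u => //.
have half_lt : eps / 2 < eps by lra.
apply: le_lt_trans half_lt; apply/(supnorm_leP (a - u)); first by rewrite ltW// divr_gt0.
move=> t; rewrite -[(a - u) t]/(a t - u t).
rewrite -(subrK (interpolant n h (mu *: x0) b t) (a t)) -addrA.
rewrite (le_trans (ler_normD _ _))// (distrC _ (u t)).
by have := ab t; have := uT t; rewrite /interpolant; lra.
Qed.
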